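(* Let $n\ge 4$ be an integer with $n\equiv 3,5,7,9,11$ or $13 \pmod{14}$. Then there exists a configuration $(2,4)$ $GDD\left(n,2,6;7n,8(n-1)\right)$.
   Context: A $GDD(n,2,6;\lambda_1,\lambda_2)$ is a finite collection (repetitions allowed) of $6$-element subsets, called blocks, of a $2n$-element set $X$ partitioned into two groups of size $n$, such that every point lies in the same number $r$ of blocks, any two distinct points of the same group lie together in exactly $\lambda_1$ blocks, and any two points from different groups lie together in exactly $\lambda_2$ blocks. It has configuration $(2,4)$ if every block has exactly $2$ points in one of the two groups and $4$ points in the other (which group contains the $2$ points may depend on the block). *)

(* Defs.v *)
From mathcomp Require Import all_boot.

Set Implicit Arguments.
Unset Strict Implicit.
Unset Printing Implicit Defensive.

(* Blocks form a [seq] because repeated blocks are allowed; its order is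
   irrelevant, as blocks are only ever counted or quantified over. *)
Record is_GDD (X : finType) (n m k l1 l2 : nat)
    (groups : {set {set X}}) (blocks : seq {set X}) : Prop := IsGDD {
  GDD_partition : partition groups [set: X];
  GDD_num_groups : #|groups| = m;
  GDD_group_size : forall G, G \in groups -> #|G| = n;
  GDD_block_size : forall B, B \in blocks -> #|B| = k;
  GDD_regular :
    exists r : nat,
      forall x : X, count (fun B : {set X} => x \in B) blocks = r;
  GDD_same_group :
    forall (G : {set X}) (x y : X),
      G \in groups -> x \in G -> y \in G -> x != y ->
      count (fun B : {set X} => (x \in B) && (y \in B)) blocks = l1;
  GDD_diff_group :
    forall (G H : {set X}) (x y : X),
      G \in groups -> H \in groups -> G != H -> x \in G -> y \in H ->
      count (fun B : {set X} => (x \in B) && (y \in B)) blocks = l2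
}.

(* The pair (G, H) depends on the block, so either group may hold the s points. *)
Definition has_configuration (X : finType) (s t : nat)
    (groups : {set {set X}}) (blocks : seq {set X}) : Prop :=
  forall B, B \in blocks ->
    exists G H : {set X},
      [/\ G \in groups, H \in groups, G != H,
          #|B :&: G| = s & #|B :&: H| = t].

(* Main.v *)
(** Let [G] be an abelian group of odd order [n = 2h + 1], [H] a set of [h]
    elements representing the nonzero elements of [G] up to sign, and [L] a list
    of [h] four-element subsets of [G] whose differences cover every nonzero
    element exactly 6 times.  Pair each [d] in [H] with one [b] in [L]; the
    blocks [{i, i + d}] in one copy of [G] together with [j + b] in the other,
    for all [i], [j] and both orders of the copies, form the required design.

    A commutative ring with four elements [S] at pairwise unit distances gives
    [L = {d S | d in H}]: take [S = {0, 1, 2, 3}] when [n] is prime to 3, and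
    [GF(3^k) x Z_m] when [n = 3^k m] with [k >= 2].  For [n = 3 m] with [m]
    prime to 3, work in [Z_3 x Z_m] with three patterns multiplied by each [d],
    and change the patterns at a single [d] so as to cover also the two nonzero
    differences in [Z_3 x 0]. *)

Require Import Defs.
From HB Require Import structures.
From mathcomp Require Import all_boot all_algebra all_field zify.

Set Implicit Arguments.
Unset Strict Implicit.
Unset Printing Implicit Defensive.

Import GRing.Theory.

(** * Half systems, difference families and the blocks built from them *)

Definition diffs (G : zmodType) (b : seq G) : seq G :=
  [seq (s - t)%R | s <- b, t <- b].

(** A choice of one element from each pair of opposite nonzero elements, stated through
    multiplicities so that sums over [H] can use it directly. At [x = 0] it excludes 0 from [H]. *)
Definition half_system (G : zmodType) (H : seq G) : Prop :=
  forall x : G, count_mem x H + count_mem (- x)%R H = (x != 0%R).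

(** Only nonzero [f] are constrained because [diffs] also lists the zero differences [s - s]. *)
Definition difference_family (G : zmodType) (k l : nat) (L : seq (seq G)) :
    Prop :=
  (forall b, b \in L -> uniq b /\ size b = k) /\
  (forall f : G, f != 0%R -> \sum_(b <- L) count_mem f (diffs b) = l).

Definition side (G : finType) (c : bool) : {set bool * G} :=
  [set x | x.1 == c].

(** The boolean [c] names the copy of [G] that receives the two points; the translate of [b] lies in
    the other copy. *)
Definition block (G : finZmodType) (c : bool) (d : G) (b : seq G) (i j : G) :
    {set bool * G} :=
  [set x | if x.1 == c then (x.2 == i) || (x.2 == i + d)%R
           else (x.2 - j)%R \in b].

Definition gdd_blocks (G : finZmodType) (H : seq G) (L : seq (seq G)) :
    seq {set bool * G} :=
  [seq block p.1 p.2.1 p.2.2 q.1 q.2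
     | p <- [seq (c, db) | c <- [:: false; true], db <- zip H L],
       q <- [seq (i, j) | i <- index_enum G, j <- index_enum G]].

(** * Existence and size of half systems; counting translates *)

Lemma sum_count_mem (T : finType) (s : seq T) :
  \sum_(x : T) count_mem x s = size s.
Proof.
under eq_bigr do rewrite -sum1_count big_mkcond.
rewrite exchange_big /= -sum1_size; apply: eq_bigr => y _.
by rewrite -big_mkcond (big_pred1 y) // => x; rewrite eq_sym.
Qed.

Lemma sum_nat_seq_const (T : Type) (s : seq T) (k : nat) :
  \sum_(x <- s) k = size s * k.
Proof. by rewrite big_const_seq count_predT iter_addn_0 mulnC. Qed.

Lemma sum_eq1 (T : finType) (y : T) : \sum_(x : T) (x == y) = 1.
Proof. by rewrite (bigD1 y) //= eqxx big1 // => x /negbTE ->. Qed.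

(** A nonzero [x] differs from [- x], so exactly one of the two comes first in a fixed enumeration
    of [G]; [H] keeps that one. *)
Lemma half_system_exists (G : finZmodType) :
  (forall x : G, (x + x = 0)%R -> x = 0%R) -> exists H : seq G, half_system H.
Proof.
move=> tf.
exists [seq x <- index_enum G | enum_rank x < enum_rank (- x)%R] => x.
rewrite !count_uniq_mem; [|exact/filter_uniq/index_enum_uniq..].
rewrite !mem_filter !mem_index_enum.
rewrite opprK !andbT.
have [->|x0] := eqVneq x 0%R; first by rewrite oppr0 ltnn.
have: enum_rank x != enum_rank (- x)%R.
  apply: contraNneq x0 => /enum_rank_inj xN; apply/eqP/tf.
  by rewrite {1}xN addNr.
by rewrite -(inj_eq val_inj) /=; case: ltngtP.
Qed.

Lemma half_system_neq0 (G : zmodType) (H : seq G) (d : G) :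
  half_system H -> d \in H -> d != 0%R.
Proof.
move=> hH; apply: contraTneq => ->.
have := hH 0%R; rewrite oppr0 eqxx -has_pred1 has_count.
by case: count.
Qed.

(** Sum the defining identity over all of [G], reindexing the second count by negation. *)
Lemma half_system_card (G : finZmodType) (H : seq G) :
  half_system H -> #|G| = (size H).*2.+1.
Proof.
move=> hH; rewrite -addnn -{1}sum_count_mem -(sum_count_mem H).
rewrite [X in _ + X](reindex_inj oppr_inj) -big_split /=.
under eq_bigr do rewrite hH.
rewrite (eq_bigr (fun x => (x \in predC1 (0%R : G) : nat))) // -big_mkcond /=.
by rewrite sum1_card cardC1 prednK //; apply/card_gt0P; exists 0%R.
Qed.

Lemma sum_pair_cover (G : finZmodType) (d x : G) :
  d != 0%R -> \sum_(i : G) ((x == i) || (x == i + d)%R) = 2.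
Proof.
move=> d0; rewrite -[2]/(1 + 1) -{1}(sum_eq1 x) -(sum_eq1 (x - d)%R) -big_split.
apply: eq_bigr => i _ /=; rewrite [i == x]eq_sym -subr_eq [i == (x - d)%R]eq_sym.
case: eqP => // <-; case: eqP => // /eqP.
by rewrite subr_eq addrC -subr_eq subrr eq_sym (negbTE d0).
Qed.

(** The pair [{i, i + d}] equals [{x, y}] only for [i = x], [d = y - x] or for [i = y],
    [d = x - y]. *)
Lemma sum_pair_cover2 (G : finZmodType) (d x y : G) : d != 0%R -> x != y ->
  \sum_(i : G) (((x == i) || (x == i + d)%R) && ((y == i) || (y == i + d)%R))
  = (d == y - x)%R + (d == x - y)%R.
Proof.
move=> d0 xy.
transitivity (\sum_(i : G) ((i == x) * (d == y - x)%R + (i == y) * (d == x - y)%R)).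
  apply: eq_bigr => i _.
  rewrite ![_ == (_ - _)%R]eq_sym !subr_eq ![(d + _)%R]addrC.
  have [->|ix] := eqVneq i x.
    by rewrite [y == x]eq_sym (negbTE xy) /= mul1n mul0n addn0.
  rewrite mul0n add0n /=.
  have [->|iy] := eqVneq i y; first by rewrite andbT mul1n.
  rewrite mul0n /=.
  by case: eqP => //= xd; case: eqP => //= yd; rewrite xd yd eqxx in xy.
by rewrite big_split /= -!big_distrl /= !sum_eq1 !mul1n.
Qed.

Lemma sum_translate (G : finZmodType) (b : seq G) (x : G) :
  uniq b -> \sum_(j : G) ((x - j)%R \in b) = size b.
Proof.
move=> ub; rewrite -sum_count_mem (reindex_inj (subrI x)) /=.
by apply: eq_bigr => j _; rewrite subKr count_uniq_mem.
Qed.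

(** Substituting [j = x - s] turns the condition into [s] and [s - (x - y)] both lying in [b], which
    is a pair of entries with difference [x - y]. *)
Lemma sum_translate2 (G : finZmodType) (b : seq G) (x y : G) : uniq b ->
  \sum_(j : G) (((x - j)%R \in b) && ((y - j)%R \in b))
  = count_mem (x - y)%R (diffs b).
Proof.
move=> ub; rewrite -sum1_count [RHS]big_mkcond big_allpairs_dep /=.
rewrite (reindex_inj (subrI x)) /=.
rewrite [RHS]big_uniq // [RHS]big_mkcond /=; apply: eq_bigr => s _.
rewrite subKr; case: (s \in b) => //=.
rewrite -big_mkcond sum1_count -count_uniq_mem //; apply: eq_count => t /=.
have -> : (y - (x - s) = s - (x - y))%R by rewrite !opprB addrCA.
by rewrite eq_sym !subr_eq addrC.
Qed.

Lemma mem_zip (S T : eqType) (s : seq S) (t : seq T) (p : S * T) :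
  size s = size t -> p \in zip s t -> p.1 \in s /\ p.2 \in t.
Proof.
move=> st pst; split.
  by rewrite -(@unzip1_zip _ _ s t) ?st // map_f.
by rewrite -(@unzip2_zip _ _ s t) ?st // map_f.
Qed.

(** * Point and pair counts in the block list *)

Lemma count_gdd_blocks (G : finZmodType) (H : seq G) (L : seq (seq G))
    (P : pred {set bool * G}) :
  count P (gdd_blocks H L) =
  \sum_(c <- [:: false; true]) \sum_(p <- zip H L) \sum_(i : G) \sum_(j : G)
    P (block c p.1 p.2 i j).
Proof.
rewrite -sum1_count [LHS]big_mkcond !big_allpairs_dep /=.
apply: eq_bigr => c _; apply: eq_bigr => p _.
rewrite big_allpairs_dep; apply: eq_bigr => i _.
by apply: eq_bigr => j _; case: (P _).
Qed.

(** If [x] and [y] are on the two-point side, the half system leaves one [d] and one [i], while [j]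
    is free: [#|G|] blocks. If they are on the other side, [i] is free and the difference family
    gives [l] choices of [b] and [j]: [#|G| * l] blocks. *)
Lemma count_gdd_blocks_same (G : finZmodType) (H : seq G) (L : seq (seq G))
    (c : bool) (x y : G) (k l : nat) :
  half_system H -> difference_family k l L -> size L = size H -> x != y ->
  count (fun B : {set bool * G} => ((c, x) \in B) && ((c, y) \in B))
    (gdd_blocks H L) = #|G| * l.+1.
Proof.
move=> hH [bL fL] szL xy; rewrite count_gdd_blocks.
have own : \sum_(p <- zip H L) \sum_(i : G) \sum_(j : G)
  (((c, x) \in block c p.1 p.2 i j) && ((c, y) \in block c p.1 p.2 i j)) = #|G|.
  transitivity (\sum_(d <- H) #|G| * ((d == y - x)%R + (d == x - y)%R)).
    rewrite -[X in _ = \sum_(d <- X) _](@unzip1_zip _ _ H L) ?szL // big_map.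
    rewrite !big_seq; apply: eq_bigr => p pHL.
    have [/(half_system_neq0 hH) p0 _] := mem_zip (esym szL) pHL.
    rewrite -sum_pair_cover2 // big_distrr; apply: eq_bigr => i _ /=.
    rewrite (eq_bigr (fun=> ((x == i) || (x == i + p.1)%R)
        && ((y == i) || (y == i + p.1)%R) : nat)).
      by rewrite sum_nat_const.
    by move=> j _; rewrite !inE /= eqxx.
  rewrite -big_distrr /= big_split /=.
  have e z : \sum_(d <- H) (d == z) = count_mem z H.
    by rewrite -sum1_count [RHS]big_mkcond; apply: eq_bigr => d _ /=; case: eqP.
  by rewrite !e addnC -[(y - x)%R]opprB hH subr_eq0 xy muln1.
have other : \sum_(p <- zip H L) \sum_(i : G) \sum_(j : G)
  (((c, x) \in block (~~ c) p.1 p.2 i j)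
     && ((c, y) \in block (~~ c) p.1 p.2 i j)) = #|G| * l.
  rewrite -(fL (x - y)%R) ?subr_eq0 // big_distrr /=.
  rewrite -[X in _ = \sum_(d <- X) _](@unzip2_zip _ _ H L) ?szL // big_map.
  rewrite !big_seq; apply: eq_bigr => p pHL.
  have [_ /bL[ub _]] := mem_zip (esym szL) pHL.
  rewrite -sum_translate2 // -sum_nat_const; apply: eq_bigr => i _.
  by apply: eq_bigr => j _; rewrite !inE /=; case: (c).
rewrite !big_cons big_nil addn0 mulnS.
by case: c own other => /= -> ->; rewrite // addnC.
Qed.

(** The conditions on [i] and [j] are independent: for each orientation and each pair [(d, b)] there
    are 2 choices of [i] and [k] of [j]. *)
Lemma count_gdd_blocks_diff (G : finZmodType) (H : seq G) (L : seq (seq G))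
    (c : bool) (x y : G) (k l : nat) :
  half_system H -> difference_family k l L -> size L = size H ->
  count (fun B : {set bool * G} => ((c, x) \in B) && ((~~ c, y) \in B))
    (gdd_blocks H L) = size H * (4 * k).
Proof.
move=> hH [bL fL] szL; rewrite count_gdd_blocks.
have one c' : \sum_(p <- zip H L) \sum_(i : G) \sum_(j : G)
  (((c, x) \in block c' p.1 p.2 i j) && ((~~ c, y) \in block c' p.1 p.2 i j))
  = size H * (2 * k).
  transitivity (\sum_(p <- zip H L) 2 * k); last first.
    by rewrite sum_nat_seq_const size_zip szL minnn.
  rewrite !big_seq; apply: eq_bigr => p pHL.
  have [/(half_system_neq0 hH) p0 /bL[ub <-]] := mem_zip (esym szL) pHL.
  (* [z] is the point on the two-point side and [w] the point on the other side. *)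
  pose z := if c == c' then x else y; pose w := if c == c' then y else x.
  rewrite -(sum_pair_cover z p0) -(sum_translate w ub) big_distrl /=.
  apply: eq_bigr => i _; rewrite big_distrr /=; apply: eq_bigr => j _.
  rewrite !inE /= /z /w mulnb.
  by case: (c) (c') => [] [] //=; rewrite andbC.
by rewrite !big_cons big_nil !one addn0 -mulnDr -mulnDl.
Qed.

Lemma count_gdd_blocks_point (G : finZmodType) (H : seq G) (L : seq (seq G))
    (x : bool * G) (k l : nat) :
  half_system H -> difference_family k l L -> size L = size H ->
  count (fun B : {set bool * G} => x \in B) (gdd_blocks H L)
  = #|G| * (size H * (2 + k)).
Proof.
case: x => c x hH [bL fL] szL; rewrite count_gdd_blocks.
have own : \sum_(p <- zip H L) \sum_(i : G) \sum_(j : G)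
  ((c, x) \in block c p.1 p.2 i j) = #|G| * (size H * 2).
  transitivity (\sum_(p <- zip H L) #|G| * 2); last first.
    by rewrite sum_nat_seq_const size_zip szL minnn mulnCA.
  rewrite !big_seq; apply: eq_bigr => p pHL.
  have [/(half_system_neq0 hH) p0 _] := mem_zip (esym szL) pHL.
  rewrite -(sum_pair_cover x p0) -sum_nat_const exchange_big /=.
  apply: eq_bigr => i _; apply: eq_bigr => j _.
  by rewrite !inE /= eqxx.
have other : \sum_(p <- zip H L) \sum_(i : G) \sum_(j : G)
  ((c, x) \in block (~~ c) p.1 p.2 i j) = #|G| * (size H * k).
  transitivity (\sum_(p <- zip H L) #|G| * k); last first.
    by rewrite sum_nat_seq_const size_zip szL minnn mulnCA.
  rewrite !big_seq; apply: eq_bigr => p pHL.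
  have [_ /bL[ub <-]] := mem_zip (esym szL) pHL.
  rewrite -(sum_translate x ub) -sum_nat_const; apply: eq_bigr => i _.
  by apply: eq_bigr => j _; rewrite !inE /=; case: (c).
rewrite !big_cons big_nil addn0 !mulnDr.
by case: c own other => /= -> ->; rewrite // addnC.
Qed.

(** * Shape of the blocks and assembly of the design *)

Lemma mem_gdd_blocks (G : finZmodType) (H : seq G) (L : seq (seq G))
    (B : {set bool * G}) :
  size L = size H -> B \in gdd_blocks H L ->
  exists c d b i j, [/\ d \in H, b \in L & B = block c d b i j].
Proof.
move=> szL /allpairsP[[cp [i j]] [cpHL _ ->]]; move: cpHL.
move=> /allpairsP[[c' p'] [/= _ + ->]] => /(mem_zip (esym szL))[dH bL].
by exists c', p'.1, p'.2, i, j.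
Qed.

Lemma card_block_own_side (G : finZmodType) (c : bool) (d : G) (b : seq G)
    (i j : G) :
  d != 0%R -> #|block c d b i j :&: side G c| = 2.
Proof.
move=> d0; have -> : block c d b i j :&: side G c = [set (c, i); (c, i + d)%R].
  apply/setP=> -[c' x]; rewrite !inE /= -!pair_eqE /= /pair_eq /=.
  by case: eqP => //=; rewrite ?andbT ?andbF.
rewrite cards2 -pair_eqE /pair_eq /= eqxx /=.
by rewrite -{1}[i]addr0 (inj_eq (addrI i)) eq_sym d0.
Qed.

Lemma card_block_other_side (G : finZmodType) (c : bool) (d : G) (b : seq G)
    (i j : G) :
  uniq b -> #|block c d b i j :&: side G (~~ c)| = size b.
Proof.
move=> ub; pose f s := (~~ c, s + j)%R.
have -> : block c d b i j :&: side G (~~ c) = [set x in map f b].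
  apply/setP=> -[c' x]; rewrite !inE /=.
  apply/idP/mapP => [/andP[xb /eqP c'E]|[s sb [-> ->]]].
    exists (x - j)%R; last by rewrite /f subrK c'E.
    by move: xb; rewrite c'E; case: (c).
  by rewrite eqxx addrK sb; case: (c).
rewrite cardsE -(size_map f); apply/card_uniqP.
by rewrite map_inj_uniq // => s t [] /addIr.
Qed.

(** The cardinality hypothesis makes [L] as long as a half system, so [zip] loses nothing. The
    counts with [k = 4], [l = 6] give [7 * #|G|] and [16 * size H], and [#|G| - 1] is twice
    [size H]. *)
Lemma gdd_of_difference_family (G : finZmodType) (L : seq (seq G)) :
  (forall x : G, (x + x = 0)%R -> x = 0%R) ->
  difference_family 4 6 L -> #|G| = (size L).*2.+1 ->
  exists (X : finType) (groups : {set {set X}}) (blocks : seq {set X}),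
    is_GDD #|G| 2 6 (7 * #|G|) (8 * (#|G| - 1)) groups blocks /\
    has_configuration 2 4 groups blocks.
Proof.
move=> tf dL cG; have [H hH] := half_system_exists tf.
have szL : size L = size H.
  by have := half_system_card hH; rewrite cG; lia.
pose groups := [set side G false; side G true].
have inG c : side G c \in groups by rewrite !inE; case: c; rewrite eqxx ?orbT.
have neqG c : side G c != side G (~~ c).
  by apply/eqP => /setP/(_ (c, 0%R)); rewrite !inE eqxx; case: (c).
have groupsP S : S \in groups -> exists c, S = side G c.
  by rewrite !inE => /orP[] /eqP->; [exists false | exists true].
have card_side c : #|side G c| = #|G|.
  transitivity #|pair c @: [set: G]|.
    apply: eq_card => -[c' x]; rewrite inE /=.
    by apply/eqP/imsetP => [->|[y _ [-> _]]] //; exists x.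
  by rewrite card_imset ?cardsT // => x y [].
have conf : has_configuration 2 4 groups (gdd_blocks H L).
  move=> B /(mem_gdd_blocks szL)[c [d [b [i [j [dH bL ->]]]]]].
  have [ub sb] := dL.1 _ bL.
  exists (side G c), (side G (~~ c)); rewrite !inG neqG.
  by rewrite card_block_own_side ?(half_system_neq0 hH) //
    card_block_other_side.
exists (bool * G)%type, groups, (gdd_blocks H L); split=> //; split.
- apply/and3P; split.
  + rewrite eqEsubset subsetT /=; apply/subsetP => -[c x] _.
    by apply/bigcupP; exists (side G c); rewrite ?inG // inE.
  + apply/trivIsetP => S T /groupsP[c ->] /groupsP[c' ->] ST.
    rewrite -setI_eq0; apply/eqP/setP => x; rewrite !inE.
    by apply: contraNF ST => /andP[/eqP <- /eqP <-].
  + apply/negP => /groupsP[c] /setP/(_ (c, 0%R)).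
    by rewrite !inE eqxx.
- by rewrite cards2 (neqG false).
- by move=> S /groupsP[c ->].
- move=> B /(mem_gdd_blocks szL)[c [d [b [i [j [dH bL ->]]]]]].
  have [ub sb] := dL.1 _ bL.
  rewrite -(cardsID (side G c)) card_block_own_side ?(half_system_neq0 hH) //.
  have -> : block c d b i j :\: side G c = block c d b i j :&: side G (~~ c).
    by apply/setP => x; rewrite !inE andbC; case: (x.1) (c) => [] [].
  by rewrite card_block_other_side // sb.
- exists (#|G| * (size H * (2 + 4))) => x.
  exact: (count_gdd_blocks_point x hH dL szL).
- move=> S [c x] [c' y] /groupsP[c'' ->]; rewrite !inE /= => /eqP-> /eqP-> xy.
  rewrite (count_gdd_blocks_same c'' hH dL szL) 1?mulnC //.
  by apply: contraNneq xy => ->.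
- move=> S T [c x] [c' y] /groupsP[a ->] /groupsP[a' ->] aa'.
  rewrite !inE /= => /eqP-> /eqP->.
  have -> : a' = ~~ a by case: a a' aa' => [] []; rewrite ?eqxx.
  rewrite (count_gdd_blocks_diff a x y hH dL szL).
  by rewrite (half_system_card hH) subn1 /= -muln2; lia.
Qed.

(** * Differences multiplied by a half system *)

Lemma big_diffs (G : zmodType) (b : seq G) (F : G -> nat) :
  \sum_(u <- diffs b) F u = \sum_(s <- b) \sum_(t <- b) F (s - t)%R.
Proof. exact: big_allpairs_dep. Qed.

Lemma map_diffs (G K : zmodType) (h : G -> K) (b : seq G) :
  {morph h : s t / (s - t)%R} -> diffs (map h b) = map h (diffs b).
Proof.
move=> hB; rewrite /diffs map_allpairs allpairs_mapl allpairs_mapr.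
by apply: eq_allpairs => s t; rewrite hB.
Qed.

Lemma perm_opp_diffs (G : zmodType) (b : seq G) :
  perm_eq (map -%R%R (diffs b)) (diffs b).
Proof.
apply/permP => a; rewrite count_map -!sum1_count big_mkcond [RHS]big_mkcond /=.
rewrite !big_diffs exchange_big; apply: eq_bigr => s _; apply: eq_bigr => t _.
by rewrite /= opprB.
Qed.

Lemma count_neq0_diffs (G : zmodType) (b : seq G) :
  uniq b -> count (predC1 0%R) (diffs b) = size b * (size b).-1.
Proof.
move=> ub; rewrite -sum1_count big_mkcond big_diffs -sum_nat_seq_const.
rewrite !big_seq; apply: eq_bigr => s sb.
rewrite -big_mkcond sum1_count /=.
rewrite (eq_count (a2 := predC (pred1 s))) => [|t /=]; last first.
  by rewrite subr_eq0 eq_sym.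
by rewrite -(count_predC (pred1 s) b) count_uniq_mem // sb.
Qed.

(** For a unit [u], the solutions of [u * d = f] and [- u * d = f] in [H] are the occurrences of
    [u^-1 * f] and of its opposite, hence exactly one in total. As [D] is symmetric, doubling the
    sum lets each [u] be matched with [- u]. *)
Lemma count_half_system_mul (R : comUnitRingType) (H D : seq R) (f : R) :
  half_system H -> perm_eq (map -%R%R D) D ->
  {in D, forall u, u != 0%R -> u \is a GRing.unit} -> f != 0%R ->
  (\sum_(d <- H) count_mem f [seq u * d | u <- D]%R).*2
  = count (predC1 0%R) D.
Proof.
move=> hH DN Dunit f0.
pose e (u : R) := count (fun d => u * d == f)%R H.
have -> : \sum_(d <- H) count_mem f [seq u * d | u <- D]%R = \sum_(u <- D) e u.
  transitivity (\sum_(d <- H) \sum_(u <- D) ((u * d)%R == f)).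
    apply: eq_bigr => d _; rewrite count_map -sum1_count big_mkcond.
    by apply: eq_bigr => u _ /=; case: eqP.
  rewrite exchange_big; apply: eq_bigr => u _.
  rewrite /e -sum1_count [RHS]big_mkcond.
  by apply: eq_bigr => d _ /=; case: eqP.
(* One of the two copies of the sum is reindexed by negation. *)
rewrite -addnn -{1}(perm_big _ DN) /= big_map -big_split /=.
rewrite -sum1_count [RHS]big_mkcond !big_seq; apply: eq_bigr => u uD /=.
have [->|u0] := eqVneq u 0%R.
  rewrite /e oppr0 (eq_count (a2 := pred0)) ?count_pred0 // => d /=.
  by rewrite mul0r eq_sym (negbTE f0).
have uU := Dunit u uD u0.
have eE v : v \is a GRing.unit -> e v = count_mem (v^-1 * f)%R H.
  move=> vU; apply: eq_count => d /=.
  by rewrite -(inj_eq (mulrI vU) d) mulVKr.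
rewrite !eE ?unitrN // invrN mulNr addnC hH.
by rewrite -(inj_eq (mulrI uU)) mulVKr // mulr0 f0.
Qed.

Lemma unit_difference_family (R : comUnitRingType) (H S : seq R) :
  half_system H -> uniq S -> size S = 4 ->
  {in S &, forall s t, s != t -> (s - t)%R \is a GRing.unit} ->
  difference_family 4 6 [seq [seq s * d | s <- S]%R | d <- H].
Proof.
move=> hH uS sS unitS; split=> [_ /mapP[d dH ->]|f f0].
  rewrite size_map sS; split=> //; rewrite map_inj_in_uniq // => s t sS' tS'.
  move=> /eqP; rewrite -subr_eq0 -mulrBl; apply: contraTeq => st.
  rewrite -(mulr0 (s - t)%R) (inj_eq (mulrI (unitS s t sS' tS' st))).
  exact: half_system_neq0 dH.
(* The doubled count is [4 * 3 = 12], the number of nonzero differences of [S]. *)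
apply/double_inj; rewrite big_map.
rewrite (eq_bigr (fun d => count_mem f [seq u * d | u <- diffs S]%R)); last first.
  by move=> d _; rewrite (map_diffs (h := fun s => s * d)%R) // => s t;
    apply: mulrBl.
rewrite (count_half_system_mul hH) ?perm_opp_diffs //.
  by rewrite count_neq0_diffs // sS.
by move=> _ /allpairsP[[s t] [/= sS' tS' ->]]; rewrite subr_eq0; apply: unitS.
Qed.

(** * Patterns for three times an order prime to 6 *)

(* Found by computer search.  The integer coefficients of the differences have
   absolute value at most 4, hence are units as soon as 2 and 3 are. *)
Definition generic_patterns : seq (seq ('Z_3 * int)) :=
  [:: [:: (0, 0); (0, 1); (2%R, 2); (0, 3)];
      [:: (0, 0); (1, 1); (0, 3); (1, 4)];
      [:: (0, 0); (2%R, 1); (1, 2); (2%R, 4)]]%R.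

(** Four patterns in place of three: with [#|R| = 2h + 1], the group ['Z_3 * R] needs [3h + 1] base
    blocks, one more than three per element of a half system. Each of the last two contains all of
    ['Z_3 * 0], and so yields [(1, 0)] and [(2, 0)] three times each. *)
Definition special_patterns : seq (seq ('Z_3 * int)) :=
  [:: [:: (0, 0); (1, 1); (0, 3); (1, 4)];
      [:: (0, 0); (2%R, 1); (0, 3); (2%R, 4)];
      [:: (0, 0); (1, 0); (2%R, 0); (0, 1)];
      [:: (0, 0); (1, 0); (2%R, 0); (0, 2)]]%R.

Definition patterns_diffs (P : seq (seq ('Z_3 * int))) : seq ('Z_3 * int) :=
  flatten (map (@diffs _) P).

(** Only the second coordinate is multiplied, so scaling preserves the layers over ['Z_3]. *)
Definition scale (R : pzRingType) (d : R) (p : 'Z_3 * int) : 'Z_3 * R :=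
  (p.1, p.2%:~R * d)%R.

Definition three_fold_family (R : pzRingType) (e : R) (H : seq R) :
    seq (seq ('Z_3 * R)) :=
  [seq map (scale d) P | d <- H, P <- generic_patterns]
    ++ [seq map (scale e) P | P <- special_patterns].

Definition layer (j : 'Z_3) : seq int :=
  [seq p.2 | p <- patterns_diffs generic_patterns & p.1 == j].

(** The special patterns cover what the generic ones do, plus six times each nonzero element of
    ['Z_3 * 0]; the four extra zeros are the trivial differences of the additional pattern. *)
Lemma perm_special_patterns :
  perm_eq (patterns_diffs special_patterns)
    (patterns_diffs generic_patterns
       ++ nseq 4 (0, 0)%R ++ nseq 6 (1, 0)%R ++ nseq 6 (2%R, 0)%R).
Proof. by vm_compute. Qed.

Lemma Z3_cases (P : 'Z_3 -> Prop) : P 0%R -> P 1%R -> P 2%R -> forall j, P j.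
Proof.
move=> P0 P1 P2 [[|[|[|]]] lt_j3] //.
- by rewrite (_ : Ordinal _ = 0%R) //; apply/val_inj.
- by rewrite (_ : Ordinal _ = 1%R) //; apply/val_inj.
- by rewrite (_ : Ordinal _ = 2%R) //; apply/val_inj.
Qed.

Lemma perm_opp_layer (j : 'Z_3) : perm_eq (map -%R%R (layer j)) (layer j).
Proof. by elim/Z3_cases: j; vm_compute. Qed.

(** Twelve is twice the required 6, as [count_half_system_mul] computes a doubled count. *)
Lemma count_neq0_layer (j : 'Z_3) : count (predC1 0%R) (layer j) = 12.
Proof. by elim/Z3_cases: j; vm_compute. Qed.

Lemma layer_neq0 (j : 'Z_3) : j != 0%R -> 0%R \notin layer j.
Proof. by elim/Z3_cases: j; vm_compute. Qed.

Lemma small_layer (j : 'Z_3) : all (fun k : int => `|k| <= 4) (layer j).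
Proof. by elim/Z3_cases: j; vm_compute. Qed.

Lemma patterns_ok :
  all (fun P => [&& uniq P, size P == 4 & all (fun p => `|p.2| <= 4) (diffs P)])
    (generic_patterns ++ special_patterns).
Proof. by vm_compute. Qed.

Lemma small_unit (R : comUnitRingType) (k : int) :
  (2%:R : R)%R \is a GRing.unit -> (3%:R : R)%R \is a GRing.unit ->
  (`|k| <= 4)%N -> k != 0%R -> (k%:~R : R)%R \is a GRing.unit.
Proof.
move=> u2 u3 k4 k0.
have natU : ((`|k|%N)%:R : R)%R \is a GRing.unit.
  move: k4 k0; rewrite -absz_eq0; move: `|k|%N => [|[|[|[|[|]]]]] // _ _.
  - exact: unitr1.
  - by rewrite (natrM R 2 2) unitrM u2.
by case: k natU {k4 k0} => m //=; rewrite NegzE mulrNz unitrN.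
Qed.

Lemma scaleB (R : pzRingType) (d : R) : {morph scale d : p q / (p - q)%R}.
Proof. by move=> p q; rewrite /scale /= intrB mulrBl. Qed.

(** If two scaled points coincide, an integer coefficient kills [d]; that coefficient is zero or a
    unit, and [d] is nonzero, so it is zero. *)
Lemma uniq_scale (R : comUnitRingType) (d : R) (P : seq ('Z_3 * int)) :
  (2%:R : R)%R \is a GRing.unit -> (3%:R : R)%R \is a GRing.unit ->
  d != 0%R -> P \in generic_patterns ++ special_patterns ->
  uniq (map (scale d) P) /\ size (map (scale d) P) = 4.
Proof.
move=> u2 u3 d0 /(allP patterns_ok)/and3P[uP /eqP sP /allP small].
rewrite size_map; split=> //; rewrite map_inj_in_uniq // => p q pP qP.
move=> /eqP; rewrite -subr_eq0 -scaleB => /eqP pq0.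
have pq1 : ((p - q).1 = 0)%R := congr1 fst pq0.
have pq2 : ((p - q).2%:~R * d = 0 :> R)%R := congr1 snd pq0.
apply/eqP; rewrite -subr_eq0; apply/eqP.
have/small/= k4 : (p - q)%R \in diffs P by apply/allpairsP; exists (p, q).
suff k0 : ((p - q).2 = 0)%R by rewrite [LHS]surjective_pairing pq1 k0.
apply/eqP; apply: contraNT d0 => k0.
by rewrite -(inj_eq (mulrI (small_unit u2 u3 k4 k0))) mulr0 pq2.
Qed.

Lemma sum_diffs_scale (R : pzRingType) (d : R) (Ps : seq (seq ('Z_3 * int)))
    (f : 'Z_3 * R) :
  \sum_(P <- Ps) count_mem f (diffs (map (scale d) P))
  = count_mem f (map (scale d) (patterns_diffs Ps)).
Proof.
rewrite /patterns_diffs map_flatten count_flatten sumnE !big_map.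
by apply: eq_bigr => P _; rewrite (map_diffs _ (scaleB d)).
Qed.

Lemma count_scale_generic (R : pzRingType) (d g : R) (j : 'Z_3) :
  count_mem (j, g) (map (scale d) (patterns_diffs generic_patterns))
  = count_mem g [seq u * d | u <- [seq k%:~R | k <- layer j]]%R.
Proof.
rewrite !count_map count_filter; apply: eq_count => p.
by rewrite /= /scale -pair_eqE /pair_eq /= andbC.
Qed.

(** By [perm_special_patterns], the family behaves like the generic patterns scaled by all of
    [e :: H], plus a surplus in ['Z_3 * 0]. The generic part covers each [(j, g)] with [g] nonzero 6
    times, and the surplus covers [(1, 0)] and [(2, 0)]. *)
Lemma three_fold_difference_family (R : comUnitRingType) (e : R) (H : seq R) :
  half_system (e :: H) ->
  (2%:R : R)%R \is a GRing.unit -> (3%:R : R)%R \is a GRing.unit ->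
  difference_family 4 6 (three_fold_family e H).
Proof.
move=> hH u2 u3; split.
  move=> b; rewrite mem_cat => /orP[/allpairsP[[d P] /= [dH PP ->]]|/mapP[P PP ->]].
    apply: uniq_scale => //; last by rewrite mem_cat PP.
    by apply: (half_system_neq0 hH); rewrite inE dH orbT.
  apply: uniq_scale => //; last by rewrite mem_cat PP orbT.
  by apply: (half_system_neq0 hH); rewrite mem_head.
move=> [j g] f0.
have -> : \sum_(b <- three_fold_family e H) count_mem (j, g) (diffs b)
    = \sum_(d <- e :: H)
        count_mem (j, g) (map (scale d) (patterns_diffs generic_patterns))
      + count_mem (j, g) (map (scale e)
          (nseq 4 (0, 0)%R ++ nseq 6 (1, 0)%R ++ nseq 6 (2%R, 0)%R)).
  rewrite big_cat big_allpairs_dep big_map /= sum_diffs_scale.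
  rewrite (permP (perm_map _ perm_special_patterns)) map_cat count_cat addnA.
  rewrite big_cons [X in X + _]addnC; congr (_ + _ + _).
  by apply: eq_bigr => d _; apply: sum_diffs_scale.
rewrite (eq_bigr _ (fun d _ => count_scale_generic d _ _)).
rewrite !map_cat !count_cat !map_nseq !count_nseq /= /scale /= mul0r.
have layerU : {in [seq k%:~R | k <- layer j]%R,
    forall u : R, u != 0%R -> u \is a GRing.unit}.
  move=> _ /mapP[k kj ->] k0; apply: small_unit => //.
    exact: (allP (small_layer j)).
  by apply: contraNneq k0 => ->.
(* For [g = 0] the layer [j] has only unit coefficients, so the generic part contributes nothing and
   the surplus gives 6. *)
have [g0|g0] := eqVneq g 0%R.
  have j0 : j != 0%R by apply: contraNneq f0 => j0; rewrite j0 g0.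
  rewrite big_seq big1 => [|d /(half_system_neq0 hH) d0]; last first.
    apply/count_memPn; rewrite g0; apply/negP => /mapP[_ /mapP[k kj ->]] /esym/eqP.
    have k0 : k != 0%R by apply: contraTneq kj => ->; apply: layer_neq0.
    have kU := small_unit u2 u3 (allP (small_layer j) k kj) k0.
    by rewrite -(mulr0 (k%:~R)%R) (inj_eq (mulrI kU)) (negbTE d0).
  rewrite g0; move: j0; move: (j); apply: Z3_cases => //=.
  - by move=> _; rewrite -!pair_eqE /pair_eq /= !eqxx.
  - by move=> _; rewrite -!pair_eqE /pair_eq /= !eqxx.
(* For [g] nonzero the surplus contributes nothing and layer [j] gives half of 12. *)
rewrite -!pair_eqE /pair_eq /= ![0%R == g]eq_sym (negbTE g0) !andbF /= addn0.
apply/double_inj; rewrite (count_half_system_mul hH) //.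
  rewrite count_map -[RHS](count_neq0_layer j); apply: eq_in_count => k kj /=.
  have [->|k0] := eqVneq k 0%R; first by rewrite eqxx.
  apply/eqP => kR0; have := small_unit u2 u3 (allP (small_layer j) k kj) k0.
  by rewrite kR0 unitr0.
rewrite -map_comp (eq_map (g := (fun k => k%:~R) \o -%R)%R) => [|k /=].
  by rewrite map_comp; apply/perm_map/perm_opp_layer.
by rewrite mulrNz.
Qed.

(** * Rings with suitable units, and all odd orders *)

HB.instance Definition _ (R S : finComUnitRingType) :=
  GRing.ComUnitRing.on (R * S)%type.
HB.instance Definition _ (R S : finComUnitRingType) := Finite.on (R * S)%type.

Definition has_config_gdd (n : nat) : Prop :=
  exists (X : finType) (groups : {set {set X}}) (blocks : seq {set X}),
    is_GDD n 2 6 (7 * n) (8 * (n - 1)) groups blocks /\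
    has_configuration 2 4 groups blocks.

(** Indexing by numbers lets families in two rings be combined coordinatewise in the product. *)
Definition four_unit_differences (R : unitRingType) : Prop :=
  exists s : nat -> R, forall i j, i < 4 -> j < 4 -> i != j ->
    (s i - s j)%R \is a GRing.unit.

Lemma add_self_eq0 (R : unitRingType) (x : R) :
  (2%:R : R)%R \is a GRing.unit -> (x + x = 0 -> x = 0)%R.
Proof.
move=> u2; rewrite -mulr2n -mulr_natr => /eqP.
by rewrite -[X in _ == X](mul0r 2%:R)%R (inj_eq (mulIr u2)) => /eqP.
Qed.

Lemma gdd_of_unit_differences (R : finComUnitRingType) :
  (2%:R : R)%R \is a GRing.unit -> four_unit_differences R ->
  has_config_gdd #|R|.
Proof.
move=> u2 [s sU]; have tf x := @add_self_eq0 R x u2.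
have [H hH] := half_system_exists tf.
have uS : uniq (mkseq s 4).
  apply/mkseq_uniqP => i j i4 j4 sij; apply: contraPeq (sU i j i4 j4) => ij.
  by rewrite sij subrr unitr0 ij => /(_ isT).
apply: (gdd_of_difference_family tf
  (@unit_difference_family R H (mkseq s 4) hH uS (size_mkseq _ _) _)).
  move=> _ _ /mapP[i + ->] /mapP[j + ->]; rewrite !mem_iota => i4 j4 sij.
  by apply: sU => //; apply: contraNneq sij => ->.
by rewrite size_map; apply: half_system_card.
Qed.

Lemma four_unit_differences_nat (R : comUnitRingType) :
  (2%:R : R)%R \is a GRing.unit -> (3%:R : R)%R \is a GRing.unit ->
  four_unit_differences R.
Proof.
move=> u2 u3; exists (fun i => i%:R)%R => i j i4 j4 ij.
rewrite (_ : i%:R - j%:R = (i%:Z - j%:Z)%:~R)%R; last by rewrite intrB.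
by apply: (small_unit u2 u3); lia.
Qed.

Lemma four_unit_differences_field (F : finFieldType) :
  4 <= #|F| -> four_unit_differences F.
Proof.
rewrite cardE => F4; exists (nth 0%R (enum F)) => i j i4 j4 ij.
by rewrite unitfE subr_eq0 nth_uniq ?enum_uniq ?(leq_trans _ F4).
Qed.

Lemma four_unit_differences_prod (R S : finComUnitRingType) :
  four_unit_differences R -> four_unit_differences S ->
  four_unit_differences (R * S)%type.
Proof.
move=> [s sU] [t tU]; exists (fun i => (s i, t i)) => i j i4 j4 ij.
by apply/andP; split; [apply: sU | apply: tU].
Qed.

Lemma card_Zp_ring (m : nat) : 1 < m -> #|'Z_m| = m.
Proof. by move=> m1; rewrite card_ord Zp_cast. Qed.

Lemma gdd_three_fold (R : finComUnitRingType) :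
  (2%:R : R)%R \is a GRing.unit -> (3%:R : R)%R \is a GRing.unit ->
  has_config_gdd (3 * #|R|).
Proof.
move=> u2 u3; have tf x := @add_self_eq0 R x u2.
have [[|e H] hH] := half_system_exists tf.
  (* A half system of a ring is nonempty because 1 is nonzero. *)
  by have := hH 1%R; rewrite oner_eq0.
have -> : 3 * #|R| = #|{: 'Z_3 * R}| by rewrite card_prod card_ord.
apply: (gdd_of_difference_family _ (three_fold_difference_family hH u2 u3)).
  move=> [j x] /eqP; rewrite -pair_eqE => /andP[/= j0 /eqP/tf x0].
  congr (_, _) => //; apply: (add_self_eq0 _ (eqP j0)).
  by rewrite unitZpE.
rewrite card_prod (@card_Zp_ring 3) // (half_system_card hH)
  size_cat size_allpairs size_map.
by rewrite [size generic_patterns]/= [size special_patterns]/= /=; lia.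
Qed.

Lemma Zp_natr_unit (m k : nat) :
  1 < m -> coprime m k -> (k%:R : 'Z_m)%R \is a GRing.unit.
Proof. by move=> m1; rewrite unitZpE. Qed.

Lemma has_config_gdd_odd (n : nat) : 4 <= n -> odd n -> has_config_gdd n.
Proof.
move=> n4 n_odd; have n0 : 0 < n by lia.
have cop2 m : m %| n -> coprime m 2.
  by move=> mn; apply: coprime_dvdl mn _; rewrite coprimen2.
have [m m3 nE] := pfactor_coprime (isT : prime 3) n0.
set k := logn 3 n in nE.
have mn : m %| n by rewrite nE dvdn_mulr.
have m2 := cop2 m mn; rewrite coprime_sym in m3.
(* Split on the exponent [k] of 3 in [n]: zero, one, or at least two. *)
have [k0|k_gt0] := posnP k.
  have nm : n = m by rewrite nE k0 muln1.
  have m1 : 1 < m by lia.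
  rewrite nm -{1}(card_Zp_ring m1); have u2 := Zp_natr_unit m1 m2.
  by apply: gdd_of_unit_differences (four_unit_differences_nat _ _);
    rewrite ?Zp_natr_unit.
have [k1|k_neq1] := eqVneq k 1.
  have m1 : 1 < m by move: n4 n_odd; rewrite nE k1; lia.
  rewrite nE k1 mulnC -(card_Zp_ring m1).
  by apply: gdd_three_fold; apply: Zp_natr_unit.
have k2 : 1 < k by lia.
have [F charF cardF] := pPrimePowerField (isT : prime 3) k_gt0.
(* With [k] at least 2 the field has at least 9 elements. *)
have F4 : 4 <= #|F|.
  by rewrite cardF (leq_trans (isT : 4 <= 3 ^ 2)) // leq_pexp2l.
have u2F : (2%:R : F)%R \is a GRing.unit.
  by rewrite unitfE -(dvdn_pcharf charF).
have SF := four_unit_differences_field F4.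
(* [m = 1] is treated apart because ['Z_1] has two elements by convention, not one. *)
have [m1|m_neq1] := eqVneq m 1.
  by rewrite nE m1 mul1n -cardF; apply: gdd_of_unit_differences.
have m1 : 1 < m by have := dvdn_gt0 n0 mn; lia.
have -> : n = #|{: F * 'Z_m}| by rewrite card_prod cardF card_Zp_ring // mulnC.
apply: gdd_of_unit_differences.
  by apply/andP; split; [exact: u2F | exact: (Zp_natr_unit m1 m2)].
apply: four_unit_differences_prod => //.
by apply: four_unit_differences_nat; apply: Zp_natr_unit.
Qed.

Theorem theorem5p7 (n : nat) (hn : 4 <= n)
    (hmod : n %% 14 \in [:: 3; 5; 7; 9; 11; 13]) :
  exists (X : finType) (groups : {set {set X}}) (blocks : seq {set X}),
    is_GDD n 2 6 (7 * n) (8 * (n - 1)) groups blocks /\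
    has_configuration 2 4 groups blocks.
Proof.
apply: has_config_gdd_odd hn _.
(* An odd residue modulo the even number 14 makes [n] odd. *)
by move: hmod; rewrite !inE; lia.
Qed.
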